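(* A metrizable space $X$ is $\sigma'$-compact if and only if its universal uniformity $\mathcal U_X$ has an $\omega^\omega$-base.
   Context: A topological space $X$ is $\sigma'$-compact if the set $X'$ of its non-isolated points is $\sigma$-compact. The universal uniformity $\mathcal U_X$ is the uniformity with base consisting of the sets $\{(x,y)\in X\times X:d(x,y)<1\}$, where $d$ runs over all continuous pseudometrics on $X$. It has an $\omega^\omega$-base if it has a base $(U_\alpha)_{\alpha\in\omega^\omega}$ such that $U_\beta\subset U_\alpha$ whenever $\alpha\le\beta$ in the coordinatewise order on $\omega^\omega$. *)

(* Defs.v *)
From HB Require Import structures.
From mathcomp Require Import all_boot all_order all_algebra.
From mathcomp Require Import all_classical all_reals all_analysis.

Set Implicit Arguments.
Unset Strict Implicit.
Unset Printing Implicit Defensive.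

Import Order.TTheory GRing.Theory Num.Theory.
Import numFieldNormedType.Exports.

Local Open Scope classical_set_scope.
Local Open Scope ring_scope.

Record is_pseudometric (R : realType) (X : Type) (d : X -> X -> R) : Prop :=
  IsPseudometric {
    pseudometric_ge0 : forall x y, 0 <= d x y ;
    pseudometric_refl : forall x, d x x = 0 ;
    pseudometric_sym : forall x y, d x y = d y x ;
    pseudometric_triangle : forall x y z, d x z <= d x y + d y z }.

Definition is_metric (R : realType) (X : Type) (d : X -> X -> R) : Prop :=
  is_pseudometric d /\ forall x y, d x y = 0 -> x = y.

Definition metrizable (R : realType) (X : topologicalType) : Prop :=
  exists2 d : X -> X -> R, is_metric d &
    forall x : X, nbhs x = nbhs_ball_ (fun y e => [set z | d y z < e]) x.

Definition sigma_compact (X : topologicalType) (A : set X) : Prop :=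
  exists2 K : nat -> set X, (forall n, compact (K n)) & A = \bigcup_n K n.

Definition sigma'_compact (X : topologicalType) : Prop :=
  sigma_compact (~` isolated [set: X]).

(* Continuity of a pseudometric is joint continuity on the product space. *)
Definition continuous_pseudometric (R : realType) (X : topologicalType) :
    set (X -> X -> R) :=
  [set d | is_pseudometric d /\ continuous (fun p : X * X => d p.1 p.2)].

Definition universal_uniformity (R : realType) (X : topologicalType) :
    set_system (X * X) :=
  filter_from (@continuous_pseudometric R X)
    (fun d => [set p | d p.1 p.2 < 1]).
Arguments universal_uniformity R X _ : clear implicits.

Definition has_omega_omega_base (T : Type) (F : set_system T) : Prop :=
  exists U : (nat -> nat) -> set T,
    [/\ forall a, F (U a),
        forall A, F A -> exists a, U a `<=` A &
        forall a b, (forall n, (a n <= b n)%N) -> U b `<=` U a].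

(* Main.v *)
Require Import Defs.
From HB Require Import structures.
From mathcomp Require Import all_boot all_order all_algebra.
From mathcomp Require Import all_classical all_reals all_analysis.
From mathcomp Require Import lra.

Set Implicit Arguments.
Unset Strict Implicit.
Unset Printing Implicit Defensive.

Import Order.TTheory GRing.Theory Num.Theory.
Import numFieldNormedType.Exports.

Local Open Scope classical_set_scope.
Local Open Scope ring_scope.

(** Fix a metric [d] of [X] and let [X'] be the set of non-isolated points.

    If [X'] is the union of the compact sets [K n], the entourages [U a]
    generated by the balls of radius [1 / (a n + 1)] around the points of the
    sets [K n] form a monotone base.  They are cofinal because a continuous
    pseudometric is uniformly small near each compact set.  They belong to the
    universal uniformity because every family of balls covering [X'] generates
    an entourage ([ball_cover_entourage]).  In a metric space this needs no
    paracompactness argument: the cover has a 1-Lipschitz Lebesgue function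
    [r], positive on [X'], and
    [d x y / (d x y + min (r x) (r y))] is a continuous pseudometric.

    Conversely, let [U] be a monotone base, and write [P a x m] when the slice
    of [U a] at [x] lies in the ball of radius [1 / (m + 1)].  The relation is
    monotone in [a]; for [x] in [X'] no [a] satisfies [P a x m] for all [m];
    and every locally bounded [f : X -> nat] is dominated by some [a], that is,
    [P a x (f x)] holds on [X'].  These properties alone make [X']
    sigma-compact ([dominated_sigma_compact]); the argument is close to
    Christensen's theorem on the spaces whose compact sets have a cofinal
    family indexed monotonically by [nat -> nat].

    Two principles drive it.  Sequences of indices whose [k]-th term agrees
    with [a] below [k] have a common upper bound, so that for each [x] the
    levels [m] with [P b x m] are bounded when [b] runs over a neighbourhood
    of [a] ([bounded_on_cylinder]).  And locally bounded functions given on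
    small sets around the terms of a sequence without cluster point are all
    below a single locally bounded function ([escapes_glue]).  A diagonal
    argument with them first shows that [X'] is separable, which gives a
    countable base [B].  Call [B i] dominated by the finite sequence [s] when
    the indices extending [s] suffice to dominate every locally bounded
    function on [B i]; every set is dominated by the empty sequence.  If [B i]
    is dominated by [s], the points of [B i] that have no basic neighbourhood
    dominated by a one-term extension of [s] form a relatively compact set
    ([compact_leftover]): otherwise they would contain a sequence without
    cluster point, and gluing bad functions around its terms would contradict
    the domination of [B i].  A point outside these countably many sets could
    be followed along an infinite branch [a], each prefix of which dominates
    some neighbourhood of the point, hence every constant there; this
    contradicts boundedness near [a] ([leftovers_cover]). *)

(** * Continuous pseudometrics from Lipschitz radii *)

Section DistanceRatio.
Context (R : realType) (X : topologicalType) (d : X -> X -> R) (r : X -> R).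
Hypothesis pmd : is_pseudometric d.
Hypothesis r_ge0 : forall x, 0 <= r x.
Hypothesis r_lip : forall x y, r x <= r y + d x y.

(** With the quotient [0 / 0 = 0], this vanishes on the diagonal even where [r]
    does.  It is the bounded companion of the distance ratio metric
    [ln (1 + d x y / min (r x) (r y))] of geometric function theory: where [r]
    vanishes, a point is at distance 1 from all points at positive distance
    for [d]. *)
Definition distance_ratio x y := d x y / (d x y + Num.min (r x) (r y)).

Let min_ge0 x y : 0 <= Num.min (r x) (r y).
Proof. by rewrite le_min !r_ge0. Qed.

Let distance_ratio_le (x y : X) (D : R) :
  d x y + Num.min (r x) (r y) <= D -> d x y / D <= distance_ratio x y.
Proof.
move=> leD; have := pseudometric_ge0 pmd x y.
rewrite /distance_ratio le_eqVlt => /predU1P[<-|d_gt0]; first by rewrite !mul0r.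
have m_ge0 := min_ge0 x y.
by rewrite ler_pM2l // lef_pV2 ?posrE //; lra.
Qed.

(** Since [r] is 1-Lipschitz, the denominators of the two terms on the right of
    the triangle inequality are at most [d x y + d y z + min (r x) (r z)]; and
    the map sending [c] to [c / (c + m)] is nondecreasing. *)
Lemma distance_ratio_pseudometric : is_pseudometric distance_ratio.
Proof.
split=> [x y|x|x y|x y z].
- by rewrite divr_ge0 ?addr_ge0 ?min_ge0 ?(pseudometric_ge0 pmd).
- by rewrite /distance_ratio (pseudometric_refl pmd) mul0r.
- by rewrite /distance_ratio (pseudometric_sym pmd) minC.
set D := d x y + d y z + Num.min (r x) (r z).
have dxy := pseudometric_ge0 pmd x y; have dyz := pseudometric_ge0 pmd y z.
have rxy : r y <= r x + d x y by rewrite (pseudometric_sym pmd) r_lip.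
have ryz : r y <= r z + d y z by rewrite r_lip.
have minxy : Num.min (r x) (r y) <= r x /\ Num.min (r x) (r y) <= r y.
  by rewrite !ge_min !lexx orbT.
have minyz : Num.min (r y) (r z) <= r z /\ Num.min (r y) (r z) <= r y.
  by rewrite !ge_min !lexx orbT.
have leD1 : d x y + Num.min (r x) (r y) <= D.
  by rewrite /D; case: (leP (r x) (r z)) => ?; lra.
have leD2 : d y z + Num.min (r y) (r z) <= D.
  by rewrite /D; case: (leP (r x) (r z)) => ?; lra.
apply: le_trans (lerD (distance_ratio_le leD1) (distance_ratio_le leD2)).
rewrite -mulrDl /distance_ratio /D.
have := pseudometric_triangle pmd x y z; have := min_ge0 x z.
have := pseudometric_ge0 pmd x z.
move: (Num.min _ _) (d x z) (d x y + d y z) => m c e c_ge0 m_ge0 ce.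
have e_ge0 := le_trans c_ge0 ce.
move: c_ge0; rewrite le_eqVlt => /predU1P[<-|c_gt0].
  by rewrite mul0r divr_ge0 ?addr_ge0.
rewrite ler_pdivrMr; last lra.
rewrite mulrAC ler_pdivlMr; last lra.
by rewrite !mulrDr (mulrC e c) lerD2l ler_wpM2r.
Qed.

(** The form without division covers the points where [r] vanishes. *)
Lemma distance_ratio_le_center x y : distance_ratio x y * r x <= d x y.
Proof.
have dxy := pseudometric_ge0 pmd x y; have rx := r_ge0 x.
have rxy : r x <= d x y + Num.min (r x) (r y).
  by case: (leP (r x) (r y)) => ?; [lra | rewrite addrC r_lip].
have [r0|r_neq0] := eqVneq (r x) 0; first by rewrite r0 mulr0.
have r_gt0 : 0 < r x by rewrite lt_neqAle eq_sym r_neq0.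
by rewrite /distance_ratio mulrAC ler_pdivrMr ?ler_wpM2l//; lra.
Qed.

Lemma distance_ratio_small x y : distance_ratio x y * 2 < 1 ->
  d x y = 0 \/ d x y < r x.
Proof.
have := pseudometric_ge0 pmd x y.
rewrite le_eqVlt => /predU1P[<-|d_gt0]; first by left.
have m_ge0 := min_ge0 x y.
rewrite /distance_ratio mulrAC ltr_pdivrMr ?mul1r; last lra.
have : Num.min (r x) (r y) <= r x by rewrite ge_min lexx.
by move=> ? ?; right; lra.
Qed.

End DistanceRatio.

Lemma continuous_pseudometricP (R : realType) (X : topologicalType)
    (rho : X -> X -> R) :
  is_pseudometric rho ->
  (forall x e, 0 < e -> \forall y \near x, rho x y < e) ->
  continuous_pseudometric rho.
Proof.
move=> pm small; split=> // -[x y]; apply/cvgrPdist_lt => /= e e0.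
have e2 : 0 < e / 2 by rewrite divr_gt0.
exists ([set u | rho x u < e / 2], [set v | rho y v < e / 2]).
  by split; exact: small.
move=> [u v] /= [xu yv]; rewrite ltr_norml.
have := pseudometric_triangle pm x u v; have := pseudometric_triangle pm x v y.
have := pseudometric_triangle pm u x v; have := pseudometric_triangle pm x y v.
rewrite (pseudometric_sym pm v y) (pseudometric_sym pm u x) => h1 h2 h3 h4.
by apply/andP; split; lra.
Qed.

Lemma continuous_pseudometric_near (R : realType) (X : topologicalType)
    (D : X -> X -> R) (x : X) (e : R) :
  continuous_pseudometric D -> 0 < e -> \forall y \near x, D x y < e.
Proof.
move=> [pmD cD] e0.
have xx : (fun y : X => (x, y)) @ x --> (x, x).
  by apply: cvg_pair => //=; exact: cvg_cst.
have := cvg_comp _ _ xx (cD (x, x)); rewrite /= (pseudometric_refl pmD).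
by move=> /cvgr_lt; apply.
Qed.

(** * Radii of the form 1 / (n + 1) *)

Lemma small_invS (R : realType) (e : R) :
  0 < e -> exists n : nat, n.+1%:R^-1 < e.
Proof.
move=> e0; have [n _ /(_ n (leqnn n))] := near_infty_natSinv_lt (PosNum e0).
by exists n.
Qed.

Lemma invS_le (R : realType) (m n : nat) :
  (m <= n)%N -> n.+1%:R^-1 <= m.+1%:R^-1 :> R.
Proof. by move=> mn; rewrite lef_pV2 ?posrE // ler_nat ltnS. Qed.

Lemma invS_le1 (R : realType) (n : nat) : n.+1%:R^-1 <= 1 :> R.
Proof. by rewrite -[leRHS]invr1 (@invS_le R 0). Qed.

Lemma lt_invS_trans (R : realType) (m n : nat) (a e : R) :
  (m <= n)%N -> m.+1%:R^-1 < e -> a < n.+1%:R^-1 -> a < e.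
Proof.
by move=> mn me an; apply: lt_trans me; exact: lt_le_trans (invS_le R mn).
Qed.

(** * Common bounds of indices, and locally bounded functions *)

(** At the place [i] only the [b k] with [k <= i] may differ from [a], so the
    maximum is finite. *)
Lemma common_upper_bound (a : nat -> nat) (b : nat -> nat -> nat) :
  (forall k, mkseq (b k) k = mkseq a k) ->
  exists c, forall k i, (b k i <= c i)%N.
Proof.
move=> ba; exists (fun i => \max_(k < i.+1) b k i + a i)%N => k i.
have [ik|ki] := ltnP i k; last first.
  apply: leq_trans (leq_addr _ _).
  exact: (leq_bigmax (Ordinal (ki : (k < i.+1)%N))).
suff -> : b k i = a i by exact: leq_addl.
by have /(congr1 (nth 0%N ^~ i)) := ba k; rewrite !nth_mkseq.
Qed.

Definition locally_bounded (X : topologicalType) (f : X -> nat) :=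
  forall x : X, exists M, \forall z \near x, (f z <= M)%N.

Lemma locally_bounded_cst (X : topologicalType) (n : nat) :
  locally_bounded (fun _ : X => n).
Proof. by move=> x; exists n; near=> z. Unshelve. all: by end_near. Qed.

Lemma locally_bounded_finite (X : topologicalType) (f : nat -> X -> nat)
    (x : X) (N : nat) :
  (forall n, locally_bounded (f n)) ->
  exists M, \forall z \near x, forall n, (n < N)%N -> (f n z <= M)%N.
Proof.
move=> fb; elim: N => [|N [M IH]]; first by exists 0%N; near=> z.
have [M' fM'] := fb N x; exists (maxn M M').
near=> z => n; rewrite ltnS leq_eqVlt leq_max => /predU1P[->|nN].
  by apply/orP; right; near: z.
by apply/orP; left; move: n nN; near: z.
Unshelve. all: by end_near. Qed.

(** * Entourages generated by ball covers *)

Section MetricSpace.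
Context (R : realType) (X : topologicalType) (d : X -> X -> R).
Hypothesis md : is_metric d.
Hypothesis nbhsd :
  forall x : X, nbhs x = nbhs_ball_ (fun y e => [set z | d y z < e]) x.

Let pmd : is_pseudometric d := proj1 md.
Let d_ge0 := pseudometric_ge0 pmd.
Let d_refl := pseudometric_refl pmd.
Let d_sym := pseudometric_sym pmd.
Let d_tri := pseudometric_triangle pmd.

Local Notation X' := (~` isolated [set: X]).

Lemma near_dist x e : 0 < e -> \forall y \near x, d x y < e.
Proof.
move=> e0; have : nbhs x [set y | d x y < e] by rewrite nbhsd; exists e.
by [].
Qed.

Lemma nbhs_distP x (A : set X) :
  nbhs x A -> exists2 e, 0 < e & forall y, d x y < e -> A y.
Proof. by rewrite nbhsd => -[e /= e0 eA]; exists e. Qed.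

Lemma nonisolated_nbhs x (A : set X) :
  nbhs x A -> X' x -> exists2 y, A y & 0 < d x y.
Proof.
move=> xA nx; apply: contrapT => none; apply: nx; split; first exact/mem_set.
exists A => //; rewrite setIT; apply/seteqP; split => [y Ay|y ->]; last first.
  exact: nbhs_singleton.
apply: contrapT => yx; apply: none; exists y => //.
rewrite lt_neqAle d_ge0 andbT; apply/eqP => /esym/(proj2 md) xy.
by apply: yx; rewrite xy.
Qed.

Lemma closed_nonisolated : closed X'.
Proof.
apply: open_closedC; rewrite openE => x [_ [V xV]]; rewrite setIT => Vx.
apply: filterS (xV) => y; rewrite Vx => ->; split; first exact/mem_set.
by exists V; rewrite ?setIT.
Qed.

(** The pair [(z, t)] stands for the ball of centre [z] and radius [t]; the
    condition says that a ball contains [q.1] with a margin exceeding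
    [d q.1 q.2], so that it contains [q.2] too. *)
Definition ball_entourage (S : set (X * R)) : set (X * X) :=
  [set q | d q.1 q.2 = 0 \/ exists2 p, S p & d p.1 q.1 + d q.1 q.2 < p.2].

(** The function [r] takes at [x] the supremum of [t - d z x] over the pairs
    [(z, t)] of [S]; it is 1-Lipschitz and positive on [X'], so twice its
    distance ratio is a continuous pseudometric: at the isolated points, where
    [r] may vanish, there is nothing to check. *)
Lemma ball_cover_entourage (S : set (X * R)) :
  (forall p, S p -> p.2 <= 1) ->
  (forall x, X' x -> exists2 p, S p & d p.1 x < p.2) ->
  universal_uniformity R X (ball_entourage S).
Proof.
move=> S1 cover.
(* The value 0 keeps the set nonempty when [S] is empty. *)
pose T x := [set s | s = 0 \/ exists2 p, S p & s = p.2 - d p.1 x].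
pose r x := sup (T x).
have T0 x : T x !=set0 by exists 0; left.
have ubT x : has_ubound (T x).
  exists 1 => _ [->|[p /S1 p1 ->]] //.
  by have := d_ge0 p.1 x; lra.
have r_ge0 x : 0 <= r x by apply: ub_le_sup => //; left.
have r_ge x p : S p -> p.2 - d p.1 x <= r x.
  by move=> Sp; apply: ub_le_sup => //; right; exists p.
have r_lip x y : r x <= r y + d x y.
  apply: ge_sup => // _ [->|[p Sp ->]]; first by rewrite addr_ge0.
  by have := r_ge y p Sp; have := d_tri p.1 x y; lra.
pose rho x y := distance_ratio d r x y * 2.
have pmr := distance_ratio_pseudometric pmd r_ge0 r_lip.
have pmrho : is_pseudometric rho.
  split=> [x y|x|x y|x y z]; rewrite /rho.
  - by rewrite mulr_ge0 // (pseudometric_ge0 pmr).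
  - by rewrite (pseudometric_refl pmr) mul0r.
  - by rewrite (pseudometric_sym pmr).
  - by rewrite -mulrDl ler_wpM2r // (pseudometric_triangle pmr).
exists rho.
  apply: continuous_pseudometricP => // x e e0.
  have [xi|nxi] := pselect (isolated [set: X] x).
    case: xi => _ [V xV]; rewrite setIT => Vx; apply: filterS xV => y.
    by rewrite Vx => ->; rewrite (pseudometric_refl pmrho).
  have [p Sp px] := cover x nxi.
  have rx : 0 < r x by apply: lt_le_trans (r_ge x p Sp); lra.
  have er : 0 < e / 2 * r x by rewrite mulr_gt0 // divr_gt0.
  apply: filterS (near_dist x er) => y xy.
  have := le_lt_trans (distance_ratio_le_center pmd r_ge0 r_lip x y) xy.
  by rewrite ltr_pM2r // /rho; lra.
move=> [x y] /= /(distance_ratio_small pmd r_ge0)[|xy]; first by left.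
right; have [_ [->|[p Sp ->]] dlt] := sup_gt (T0 x) xy.
  by have := d_ge0 x y; lra.
by exists p => //; lra.
Qed.

Lemma compact_uniform_radius (K : set X) (D : X -> X -> R) (e : R) :
  compact K -> continuous_pseudometric D -> 0 < e ->
  exists n : nat, forall z, K z -> forall x, d z x < n.+1%:R^-1 -> D z x < e.
Proof.
move=> /compact_near_coveringP cK cD e0; have pmD := cD.1.
pose P (n : nat) z := forall x, d z x < n.+1%:R^-1 -> D z x < e.
suff: \forall n \near \oo, K `<=` P n.
  by case=> n _ /(_ n (leqnn n)) ?; exists n.
apply: cK => z _.
have e2 : 0 < e / 2 by rewrite divr_gt0.
have := continuous_pseudometric_near z cD e2.
move=> /nbhs_distP[t t0 tD].
have [n nt] := @small_invS _ (t / 2) (divr_gt0 t0 (ltr0Sn _ 1)).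
exists ([set z' | d z z' < t / 2], [set k | (n <= k)%N]).
  by split; [apply: near_dist; rewrite divr_gt0 | exists n].
move=> [z' k] /= [zz' nk] x /= z'x.
have xt' := lt_invS_trans nk nt z'x.
have zt : d z z' < t by lra.
have xt : d z x < t by have := d_tri z z' x; lra.
have := pseudometric_triangle pmD z' z x.
by rewrite (pseudometric_sym pmD z' z); have := tD _ zt; have := tD _ xt; lra.
Qed.

(** * Sigma-compactness gives a base *)

Lemma sigma'_compact_omega_base :
  sigma'_compact X -> has_omega_omega_base (universal_uniformity R X).
Proof.
move=> [K cK XK].
pose S (a : nat -> nat) : set (X * R) :=
  [set p | exists2 n, K n p.1 & p.2 = (a n).+1%:R^-1].
exists (fun a => ball_entourage (S a)); split.
- move=> a; apply: ball_cover_entourage => [p [n _ ->]|x].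
    exact: invS_le1.
  rewrite XK => -[n _ Kx]; exists (x, (a n).+1%:R^-1); first by exists n.
  by rewrite /= d_refl invr_gt0.
- move=> V [D cD DV]; have pmD := proj1 cD.
  have h2 : 0 < 1 / 2 :> R by rewrite divr_gt0.
  have [a aD] := choice (fun n => compact_uniform_radius (cK n) cD h2).
  (* Both points are within [1/2] of [z] for [D]. *)
  exists a => -[x y] /= [/= /(proj2 md) ->|[[z t] [n /= Kz ->] /= zxy]];
    apply: DV => /=.
    by rewrite (pseudometric_refl pmD).
  have zx : d z x < (a n).+1%:R^-1 by apply: le_lt_trans zxy; rewrite lerDl.
  have zy : d z y < (a n).+1%:R^-1 := le_lt_trans (d_tri z x y) zxy.
  have := aD n z Kz x zx; have := aD n z Kz y zy.
  have := pseudometric_triangle pmD x z y; rewrite (pseudometric_sym pmD x z).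
  by lra.
- move=> a b ab [x y] [xy|[p [n Kp pn] pxy]]; first by left.
  right; exists (p.1, (a n).+1%:R^-1); first by exists n.
  by apply: (lt_le_trans pxy); rewrite pn invS_le.
Qed.

(** * Sequences without cluster point *)

Definition escapes (y : nat -> X) :=
  forall x, exists2 e, 0 < e & \forall n \near \oo, e <= d x (y n).

(** The points of [B n] become arbitrarily close to [y n], and [y] escapes, so
    every point has a neighbourhood that meets only finitely many [B n].  Hence
    the least function that is above [f n] on [B n] for all [n] exists and is
    locally bounded. *)
Lemma escapes_glue (y : nat -> X) (B : nat -> set X) (f : nat -> X -> nat) :
  escapes y -> (forall n z, B n z -> d (y n) z < n.+1%:R^-1) ->
  (forall n, locally_bounded (f n)) ->
  exists2 g, locally_bounded g & forall n z, B n z -> (f n z <= g z)%N.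
Proof.
move=> esc By fb.
have near_few (x : X) :
    exists N, \forall z \near x, forall n, (N <= n)%N -> ~ B n z.
  have [e e0 [N _ yN]] := esc x.
  have e2 : 0 < e / 2 by rewrite divr_gt0.
  have [m me] := small_invS e2; exists (maxn N m).
  apply: filterS (near_dist x e2) => z xz n; rewrite geq_max => /andP[Nn mn].
  move=> /By /(lt_invS_trans mn me) yz; have := yN n Nn.
  by have := d_tri x z (y n); rewrite (d_sym z (y n)); lra.
pose bound z m := `[< forall n, B n z -> (f n z <= m)%N >].
have near_bound (x : X) : exists M, \forall z \near x, bound z M.
  have [N BN] := near_few x; have [M fM] := locally_bounded_finite x N fb.
  exists M; near=> z; apply/asboolP => n Bnz.
  have [nN|Nn] := ltnP n N; first by move: n nN {Bnz}; near: z.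
  exfalso; move: n Nn Bnz; near: z; exact: BN.
have ex_bound z : exists m, bound z m.
  by have [M /nbhs_singleton zM] := near_bound z; exists M.
exists (fun z => ex_minn (ex_bound z)) => [x|n z Bnz].
  have [M xM] := near_bound x; exists M; apply: filterS xM => z zM.
  by case: ex_minnP => m _; apply.
by case: ex_minnP => m /asboolP mP _; exact: mP.
Unshelve. all: by end_near. Qed.

Lemma separated_escapes (y : nat -> X) (e : R) :
  0 < e -> (forall i j, (i < j)%N -> e <= d (y i) (y j)) -> escapes y.
Proof.
move=> e0 sep x; exists (e / 2); first by rewrite divr_gt0.
have [[i xi]|none] := pselect (exists i, d x (y i) < e / 2).
  exists i.+1 => // n /= ni; rewrite leNgt; apply/negP => xn.
  have := sep i n ni; have := d_tri (y i) x (y n); rewrite (d_sym (y i) x).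
  by lra.
exists 0%N => // n _ /=; rewrite leNgt; apply/negP => xn.
by apply: none; exists n.
Qed.

Definition open_base_of (A : set X) (B : nat -> set X) :=
  (forall i x, B i x -> \forall z \near x, B i z) /\
  forall x e, A x -> 0 < e ->
    exists2 i, B i x & forall z, B i z -> d x z < e.

(** The countable base turns the clustering of sequences into compactness: a
    filter on the closure of [C] without cluster point there would contain the
    complements of countably many basic sets covering this closure, and points
    picked in their successive finite intersections would escape. *)
Lemma compact_closure_of_clustering (A C : set X) (B : nat -> set X) :
  closed A -> open_base_of A B -> C `<=` A ->
  (forall y, (forall n, C (y n)) -> ~ escapes y) -> compact (closure C).
Proof.
move=> clA [Bo Bb] CA noesc.
have noesc_cl y : (forall n, closure C (y n)) -> ~ escapes y.
  move=> yC esc.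
  have near_C n : exists z, C z /\ d (y n) z < n.+1%:R^-1.
    have [|z [Cz yz]] := yC n [set z | d (y n) z < n.+1%:R^-1].
      by apply: near_dist; rewrite // invr_gt0.
    by exists z.
  have [z zP] := choice near_C; apply: (noesc z) => [n|x].
    by have [] := zP n.
  have [e e0 [N _ yN]] := esc x.
  have e2 : 0 < e / 2 by rewrite divr_gt0.
  have [m me] := small_invS e2; exists (e / 2) => //.
  exists (maxn N m) => // n /=; rewrite geq_max => /andP[Nn mn].
  have := yN n Nn; have [_ /(lt_invS_trans mn me)] := zP n.
  by have := d_tri x (z n) (y n); rewrite (d_sym (z n) (y n)); lra.
move=> F FF FC; apply: contrapT => nocl.
have out x : closure C x -> exists2 i, B i x & F (~` B i).
  move=> Cx; apply: contrapT => nout; apply: nocl; exists x; split=> //.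
  move=> G V FG Vx.
  have [e e0 eV] := nbhs_distP Vx.
  have Ax : A x by rewrite (closure_id A).1 //; exact: closureS Cx.
  have [i Bix iV] := Bb x e Ax e0.
  apply: contrapT => GV; apply: nout; exists i => //.
  apply: filterS FG => z Gz Biz; apply: GV.
  by exists z; split=> //; exact/eV/iV.
have meets n : exists y,
    closure C y /\ forall i, (i < n)%N -> F (~` B i) -> ~ B i y.
  apply: (@filter_ex _ F); apply: filterI => //.
  elim: n => [|n IH]; first by near=> z.
  have [FB|nFB] := pselect (F (~` B n)).
    apply: filterS2 IH FB => z zn Bz i; rewrite ltnS leq_eqVlt.
    by case/predU1P => [->//|/zn].
  apply: filterS IH => z zn i; rewrite ltnS leq_eqVlt.
  by case/predU1P => [->//|/zn].
have [y yP] := choice meets; apply: (noesc_cl y) => [n|x].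
  by have [] := yP n.
have [Cx|nCx] := pselect (closure C x).
  have [i Bix Fi] := out x Cx; have [e e0 eB] := nbhs_distP (Bo i x Bix).
  exists e => //; exists i.+1 => // n /= ni; rewrite leNgt; apply/negP => /eB.
  by have [_] := yP n; exact.
have : nbhs x (~` closure C).
  by apply: open_nbhs_nbhs; split=> //; exact/closed_openC/closed_closure.
move=> /nbhs_distP[e e0 eC]; exists e => //; exists 0%N => // n _ /=.
by rewrite leNgt; apply/negP => /eC; apply; have [] := yP n.
Unshelve. all: by end_near. Qed.

(** * Domination by indices *)

Section Domination.
(** In the application [P a x m] says that the slice at [x] of the entourage of
    index [a] lies in the ball of radius [1 / (m + 1)], and [A] is the set of
    non-isolated points. *)
Context (A : set X) (P : (nat -> nat) -> X -> nat -> Prop).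
Hypothesis P_mono : forall a b x m,
  (forall n, (a n <= b n)%N) -> P a x m -> P b x m.
Hypothesis P_anti : forall a x m n, (m <= n)%N -> P a x n -> P a x m.
Hypothesis P_finite : forall a x, A x -> exists m, ~ P a x m.
Hypothesis P_dominates : forall f : X -> nat, locally_bounded f ->
  exists a, forall x, A x -> P a x (f x).

(** If indices [b k] agreeing with [a] below [k] satisfied [P (b k) x k], a
    common upper bound [c] of them would satisfy [P c x k] for all [k]. *)
Lemma bounded_on_cylinder x a : A x ->
  exists k, forall b, mkseq b k = mkseq a k -> ~ P b x k.
Proof.
move=> Ax; apply: contrapT => unb.
have pick k : exists b, mkseq b k = mkseq a k /\ P b x k.
  apply: contrapT => nb; apply: unb; exists k => b ba bx.
  by apply: nb; exists b.
have [b bP] := choice pick.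
have [c bc] := common_upper_bound (fun k => (bP k).1).
have [m] := P_finite c Ax; apply.
by apply: P_mono (bc m) _; have [] := bP m.
Qed.

(** By [bounded_on_cylinder] the sets attached to the prefixes of any given
    index cover [A]. *)
Definition bounded_part (s : seq nat) : set X :=
  [set x | A x /\ forall b, mkseq b (size s) = s -> ~ P b x (size s)].

(** Otherwise each index has a prefix [s] whose bounded part is not covered by
    finitely many balls of radius [e].  There are countably many such [s], so a
    sequence of [e]-separated points can be chosen with one in each of these
    bounded parts.  A locally bounded function that is at least [size s] at the
    point chosen for [s] is then dominated by no index. *)
Lemma bounded_parts_totally_bounded (e : R) : 0 < e ->
  exists a, forall k, exists l : seq X,
    forall x, bounded_part (mkseq a k) x -> exists2 y, y \in l & d y x < e.
Proof.
move=> e0.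
pose small s := exists l : seq X,
  forall x, bounded_part s x -> exists2 y, y \in l & d y x < e.
apply: contrapT => none.
have large a : exists k, ~ small (mkseq a k).
  apply: contrapT => alls; apply: none; exists a => k.
  by apply: contrapT => nk; apply: alls; exists k.
have [k0 large0] := large (fun=> 0%N).
(* [s_] enumerates the prefixes whose bounded part is large, the prefix given by
   [k0] filling the places that code other sequences. *)
pose code n := if unpickle n is Some s then s else [::] : seq nat.
pose s_ n := if `[< small (code n) >] then mkseq (fun=> 0%N) k0 else code n.
have large_s n : ~ small (s_ n).
  by rewrite /s_; case: asboolP.
have next (p : nat * seq X) : exists x,
    bounded_part (s_ p.1) x /\ forall y, y \in p.2 -> e <= d y x.
  apply: contrapT => nx; apply: (large_s p.1); exists p.2 => x px.
  apply: contrapT => far; apply: nx; exists x; split=> // y yp.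
  by rewrite leNgt; apply/negP => yx; apply: far; exists y.
have [nxt nxtP] := choice next.
pose hist := fix hist n :=
  if n is m.+1 then nxt (m, hist m) :: hist m else [::].
pose y n := nxt (n, hist n).
have hist_y i j : (i < j)%N -> y i \in hist j.
  elim: j => // j IH; rewrite ltnS leq_eqVlt inE => /predU1P[->|/IH ->].
    by rewrite eqxx.
  by rewrite orbT.
have esc : escapes y.
  apply: (separated_escapes e0) => i j ij.
  by have [_] := nxtP (j, hist j); apply; exact: hist_y.
have [||g gb gy] := @escapes_glue y (fun n => [set y n])
  (fun n _ => size (s_ n)) esc.
- by move=> n z ->; rewrite d_refl invr_gt0.
- by move=> n; exact: locally_bounded_cst.
have [a aP] := P_dominates gb; have [k lk] := large a.
have sk : s_ (pickle (mkseq a k)) = mkseq a k.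
  by rewrite /s_ /code pickleK; case: asboolP.
have [+ _] := nxtP (pickle (mkseq a k), hist (pickle (mkseq a k))).
rewrite /= -/(y _) => -[Ay]; apply; last first.
  by apply: P_anti (aP _ Ay); exact: gy.
by rewrite sk size_mkseq.
Qed.

Lemma exists_open_base : exists B, open_base_of A B.
Proof.
have tb m : exists l : nat -> seq X, forall x, A x ->
    exists k, exists2 y, y \in l k & d y x < m.+1%:R^-1.
  have [|a aP] := @bounded_parts_totally_bounded m.+1%:R^-1.
    by rewrite invr_gt0.
  have [l lP] := choice aP; exists l => x Ax.
  have [k kP] := bounded_on_cylinder a Ax.
  exists k; apply: lP; split=> // b; rewrite size_mkseq; exact: kP.
have [l lP] := choice tb.
(* The balls of radius [1 / (m + 1)] around the terms of the list [l m k]; the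
   default value of [nth] is harmless since [j] is less than the size. *)
pose B3 m k j := [set z | (j < size (l m k))%N /\
  d (nth z (l m k) j) z < m.+1%:R^-1].
pose B n := if unpickle n is Some (m, k, j) then B3 m k j else set0.
exists B; split=> [i x|x e Ax e0].
  rewrite /B; case: unpickle => // -[[m k] j] [jl xj].
  have e0 : 0 < m.+1%:R^-1 - d (nth x (l m k) j) x by rewrite subr_gt0.
  apply: filterS (near_dist x e0) => z; rewrite ltrBrDl => xz; split=> //.
  rewrite (set_nth_default x) //; exact: le_lt_trans (d_tri _ x z) xz.
have [m me] := small_invS (divr_gt0 e0 (ltr0Sn R 1)).
have [k [y yl yx]] := lP m x Ax.
exists (pickle (m, k, index y (l m k))); rewrite /B pickleK.
  by split; rewrite ?index_mem ?nth_index.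
move=> z [_]; rewrite nth_index // => /(lt_invS_trans (leqnn m) me) yz.
have xy := lt_invS_trans (leqnn m) me yx.
by have := d_tri x y z; rewrite (d_sym x y); lra.
Qed.

Definition dominated_on (s : seq nat) (B : set X) :=
  forall f : X -> nat, locally_bounded f ->
    exists2 a, mkseq a (size s) = s & forall x, A x -> B x -> P a x (f x).

Lemma dominated_on_nil B : dominated_on [::] B.
Proof.
by move=> f /P_dominates[a aP]; exists a => // x Ax _; exact: aP.
Qed.

(** If for each [n] a function [f n] is dominated on [C n] by no index extending
    [rcons s n], glue the [f n] into one function.  An index extending [s]
    dominates it on [B]; it extends [rcons s n] for its own value [n] at the
    place [size s], which contradicts the choice of [f n]. *)
Lemma dominated_on_rcons s (B : set X) (y : nat -> X) (C : nat -> set X) :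
  dominated_on s B -> escapes y ->
  (forall n z, C n z -> d (y n) z < n.+1%:R^-1) -> (forall n, C n `<=` B) ->
  exists n, dominated_on (rcons s n) (C n).
Proof.
move=> sB esc Cy CB; apply: contrapT => none.
have pick n : exists f : X -> nat, locally_bounded f /\
    forall a, mkseq a (size s).+1 = rcons s n ->
      ~ forall x, A x -> C n x -> P a x (f x).
  apply: contrapT => nf; apply: none; exists n => f fb.
  apply: contrapT => na; apply: nf; exists f; split=> // a as_ aP; apply: na.
  by exists a; rewrite // size_rcons.
have [f fP] := choice pick.
have [g gb gf] := escapes_glue esc Cy (fun n => (fP n).1).
have [a as_ aP] := sB g gb.
have [_ /(_ a)] := fP (a (size s)); rewrite mkseqS as_ => /(_ erefl); apply.
move=> x Ax Cx; apply: P_anti (aP x Ax (CB _ _ Cx)); exact: gf.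
Qed.

(** * Leftover sets *)

Section Leftovers.
Context (B : nat -> set X).
Hypothesis clA : closed A.
Hypothesis baseB : open_base_of A B.

Definition leftover (s : seq nat) (i : nat) : set X :=
  [set x | [/\ A x, B i x &
    forall n j, B j x -> ~ dominated_on (rcons s n) (B j)]].

(** For a sequence of leftover points that escapes, [dominated_on_rcons] applied
    to ever smaller basic sets around its terms would give one of them a
    neighbourhood that a leftover point cannot have. *)
Lemma compact_leftover s i :
  dominated_on s (B i) -> compact (closure (leftover s i)).
Proof.
move=> sB; apply: (compact_closure_of_clustering clA baseB) => [x []//|].
move=> y yL esc; have [Bo Bb] := baseB.
have pick n : exists j,
    [/\ B j (y n), B j `<=` B i & forall z, B j z -> d (y n) z < n.+1%:R^-1].
  have [Ay Biy _] := yL n.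
  have [e e0 eB] := nbhs_distP (Bo i _ Biy).
  have m0 : 0 < Num.min e n.+1%:R^-1 by rewrite lt_min e0 /= invr_gt0.
  have [j Bjy jm] := Bb (y n) _ Ay m0; exists j; split=> // z /jm.
    by rewrite lt_min => /andP[/eB].
  by rewrite lt_min => /andP[].
have [j jP] := choice pick.
have [n z|n|n nB] := dominated_on_rcons (C := B \o j) sB esc.
- by have [_ _] := jP n; apply.
- by have [] := jP n.
by have [_ _ /(_ n (j n))] := yL n; apply=> //; have [] := jP n.
Qed.

(** If [x] were in no such leftover, a branch of finite sequences could be
    followed for ever, giving an index [a] such that for all [k] some index
    that agrees with [a] below [k] dominates the constant [k] at [x]. *)
Lemma leftovers_cover x : A x ->
  exists s, exists2 i, dominated_on s (B i) & leftover s i x.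
Proof.
move=> Ax; apply: contrapT => none.
pose alive (p : seq nat * nat) := dominated_on p.1 (B p.2) /\ B p.2 x.
have next p : exists q, alive p -> alive q /\ exists n, q.1 = rcons p.1 n.
  have [ap|nap] := pselect (alive p); last by exists p.
  apply: contrapT => nq; apply: none; exists p.1, p.2; first by case: ap.
  split=> //; first by case: ap.
  move=> n j Bj sn; apply: nq; exists (rcons p.1 n, j) => _.
  by split; [|exists n].
have [nxt nxtP] := choice next.
have [i0 Bi0 _] := baseB.2 x 1 Ax ltr01.
pose st k := iter k nxt ([::], i0).
have alive_st k : alive (st k).
  elim: k => [|k IH]; first by split=> //; exact: dominated_on_nil.
  exact: (nxtP _ IH).1.
pose a k := last 0%N (st k.+1).1.
have stE k : (st k).1 = mkseq a k.
  elim: k => // k IH; rewrite mkseqS /a -IH /=.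
  by have [_ [n ->]] := nxtP _ (alive_st k); rewrite last_rcons.
have [k kP] := bounded_on_cylinder a Ax.
have [dom Bx] := alive_st k.
have [b] := dom _ (locally_bounded_cst k); rewrite stE size_mkseq => ba.
by move=> /(_ x Ax Bx); exact: kP.
Qed.

End Leftovers.

Lemma dominated_sigma_compact : closed A -> sigma_compact A.
Proof.
move=> clA; have [B baseB] := exists_open_base.
pose node n : seq nat * nat :=
  if unpickle n is Some (s, i) then (s, i) else ([::], n).
pose K n := if `[< dominated_on (node n).1 (B (node n).2) >]
  then closure (leftover B (node n).1 (node n).2) else set0.
exists K => [n|].
  rewrite /K; case: asboolP => [|_]; [exact: compact_leftover|exact: compact0].
apply/seteqP; split=> [x Ax|x [n _]].
  have [s [i sB sx]] := leftovers_cover baseB Ax.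
  exists (pickle (s, i)) => //; rewrite /K /node pickleK /=.
  by case: asboolP => // _; exact: subset_closure.
rewrite /K; case: asboolP => // _ xL; rewrite (closure_id A).1 //.
by apply: closureS xL => z [].
Qed.

End Domination.

(** * A base gives sigma-compactness *)

(** The balls [(z, t)] with [t <= 1 / (f x + 1)] at all their points [x] cover
    [X], because [f] is locally bounded. *)
Lemma locally_bounded_entourage (f : X -> nat) : locally_bounded f ->
  universal_uniformity R X [set q | d q.1 q.2 < (f q.1).+1%:R^-1].
Proof.
move=> fb.
pose S : set (X * R) := [set p | p.2 <= 1 /\
  forall x, d p.1 x < p.2 -> p.2 <= (f x).+1%:R^-1].
have [p []//|x _|D cD DV] := ball_cover_entourage (S := S).
  have [M /nbhs_distP[e e0 eM]] := fb x.
  have t0 : 0 < Num.min e M.+1%:R^-1 by rewrite lt_min e0 /= invr_gt0.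
  exists (x, Num.min e M.+1%:R^-1); last by rewrite /= d_refl.
  split=> [|z] /=; first by rewrite ge_min invS_le1 orbT.
  rewrite lt_min => /andP[/eM fM _].
  by rewrite ge_min invS_le ?orbT.
exists D => // -[x y] /DV /= [->|[p [_ pS] pxy]]; first by rewrite invr_gt0.
have px : d p.1 x < p.2 by apply: le_lt_trans pxy; rewrite lerDl.
by apply: lt_le_trans (pS x px); apply: le_lt_trans pxy; rewrite lerDr.
Qed.

Lemma omega_base_sigma'_compact :
  has_omega_omega_base (universal_uniformity R X) -> sigma'_compact X.
Proof.
move=> [U [FU baseU antiU]].
pose P a x m := forall y, U a (x, y) -> d x y < m.+1%:R^-1.
apply: (dominated_sigma_compact (P := P)).
- by move=> a b x m ab Pa y /(antiU a b ab); exact: Pa.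
- move=> a x m n mn Pn y /Pn xy; exact: lt_le_trans xy (invS_le R mn).
- move=> a x nx; have [D cD DU] := FU a.
  have xD := continuous_pseudometric_near x cD ltr01.
  have [y Dy xy] := nonisolated_nbhs xD nx.
  have [m my] := small_invS xy; exists m.
  by move=> /(_ y (DU (x, y) Dy)) /(lt_trans my); rewrite ltxx.
- move=> f /locally_bounded_entourage /baseU[a aU]; exists a => x _ y.
  exact: (aU (x, y)).
- exact: closed_nonisolated.
Qed.

End MetricSpace.

Theorem theorem8p7 (R : realType) (X : topologicalType) :
  metrizable R X ->
  (sigma'_compact X <-> has_omega_omega_base (universal_uniformity R X)).
Proof.
move=> [d md nbhsd]; split; first exact: (sigma'_compact_omega_base md nbhsd).
exact: (omega_base_sigma'_compact md nbhsd).
Qed.
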